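(* Let $G$ be a finite subgroup of $\mathrm{SU}_2$ and let $V=\mathbb{C}^2$. Then the Poincaré series $m^0(t)=\sum_{k\ge 0}\dim\bigl((V^{\otimes k})^G\bigr)t^k$ for the $G$-invariants $T(V)^G$ in $T(V)=\bigoplus_{k\ge 0}V^{\otimes k}$ is $$ m^0(t)=\frac{\det(I-t\mathring{A})}{\det(I-tA)}=\frac{\det(I-t\mathring{A})}{\prod_{g\in\Gamma}\bigl(1-\chi_V(g)t\bigr)}, $$ where $A$ is the adjacency matrix of the representation graph $\mathcal{R}_V(G)$ (i.e. of the affine Dynkin diagram corresponding to $G$), $\mathring{A}$ is the adjacency matrix of the finite Dynkin diagram obtained by removing the affine node, and $\chi_V(g)$ is the value of the character $\chi_V$ of $V$ at $g\in\Gamma$, a set of conjugacy class representatives for $G$.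
   Context: $\mathrm{SU}_2$ is the group of $2\times 2$ complex special unitary matrices, and $V=\mathbb{C}^2$ is the space of $2\times1$ column vectors on which $G\subset\mathrm{SU}_2$ acts by matrix multiplication. $V^{\otimes 0}=\mathbb{C}$ is the trivial module. $\Lambda(G)$ indexes the irreducible complex $G$-modules $G^\lambda$, with $0\in\Lambda(G)$ the index of the trivial module. The representation graph $\mathcal{R}_V(G)$ has nodes indexed by $\Lambda(G)$ and adjacency matrix $A=(a_{\mu,\lambda})$, where $a_{\mu,\lambda}$ is the multiplicity of $G^\lambda$ in $G^\mu\otimes V$. By the McKay correspondence, $\mathcal{R}_V(G)$ is a simply laced affine Dynkin diagram: up to isomorphism $G$ is a cyclic group of order $n$, a binary dihedral group of order $4n$, or the binary tetrahedral, octahedral, or icosahedral group (orders 24, 48, 120), with $\mathcal{R}_V(G)$ of type $\widehat{\mathsf{A}}_{n-1}$, $\widehat{\mathsf{D}}_{n+2}$, $\widehat{\mathsf{E}}_6$, $\widehat{\mathsf{E}}_7$, $\widehat{\mathsf{E}}_8$ respectively, the affine node being the node $0$. Thus $\mathring{A}$ is the matrix obtained from $A$ by deleting the row and column indexed by $0$. $I$ denotes the identity matrix of the appropriate size. The identities hold for formal power series in $t$. *)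

(* Defs.v *)
From HB Require Import structures.
From mathcomp Require Import all_boot all_order all_algebra all_fingroup.
From mathcomp Require Import spectral mxrepresentation character.
From mathcomp Require Import complex reals.

Set Implicit Arguments.
Unset Strict Implicit.
Unset Printing Implicit Defensive.

Import Order.TTheory GRing.Theory Num.Theory.

Local Open Scope ring_scope.

Section FormalPowerSeries.

Variable F : fieldType.

(* A formal power series is its sequence of coefficients. *)
Definition fps := nat -> F.

Implicit Types f g : fps.

Definition fps_of_poly (p : {poly F}) : fps := fun n => p`_n.

Definition fps_one : fps := fun n => (n == 0%N)%:R.

Definition fps_mul f g : fps := fun n => \sum_(i < n.+1) f i * g (n - i)%N.

(* The list of the first n coefficients of 1 / f, from the recursion
     g_m = ([m = 0] - \sum_(i < m) f_(m - i) g_i) / f_0.                      *)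
Fixpoint fps_inv_seq f (n : nat) : seq F :=
  if n is m.+1 then
    let s := fps_inv_seq f m in
    rcons s ((f 0%N)^-1 * ((m == 0%N)%:R - \sum_(i < m) f (m - i)%N * s`_i))
  else [::].

Definition fps_inv f : fps := fun n => (fps_inv_seq f n.+1)`_n.

(* Meaningful when g has a nonzero constant term, see fps_mulVf. *)
Definition fps_div f g : fps := fps_mul f (fps_inv g).

Lemma size_fps_inv_seq f n : size (fps_inv_seq f n) = n.
Proof. by elim: n => //= n IHn; rewrite size_rcons IHn. Qed.

Lemma nth_fps_inv_seq f n i : (i < n)%N -> (fps_inv_seq f n)`_i = fps_inv f i.
Proof.
elim: n => // n IHn; rewrite ltnS leq_eqVlt => /predU1P[-> // | lt_in].
by rewrite /= nth_rcons size_fps_inv_seq lt_in IHn.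
Qed.

Lemma fps_invE f n :
  fps_inv f n =
  (f 0%N)^-1 * ((n == 0%N)%:R - \sum_(i < n) f (n - i)%N * fps_inv f i).
Proof.
rewrite {1}/fps_inv /= nth_rcons size_fps_inv_seq ltnn eqxx.
by congr (_ * (_ - _)); apply: eq_bigr => i _; rewrite nth_fps_inv_seq.
Qed.

Lemma fps_mulVf f : f 0%N != 0 -> fps_mul (fps_inv f) f =1 fps_one.
Proof.
move=> f0 n; rewrite /fps_mul big_ord_recr /= subnn.
rewrite [X in _ + X]mulrC [fps_inv f n]fps_invE mulrA divff // mul1r.
rewrite (eq_bigr (fun i : 'I_n => f (n - i)%N * fps_inv f i)) => [|i _].
  by rewrite addrC subrK.
exact: mulrC.
Qed.

End FormalPowerSeries.

Definition special_unitary (C : numClosedFieldType) n (M : 'M[C]_n) : bool :=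
  (M \is unitarymx) && (\det M == 1).

Section GModules.

Variables (F : fieldType) (gT : finGroupType) (G : {group gT}).

(* The left G-module attached to rG is the space of column vectors 'cV_n, with
   g acting by v |-> rG g *m v. *)
Definition invariants n (rG : mx_representation F G n) : {vspace 'cV[F]_n} :=
  (\bigcap_(g in G) fixedSpace (linfun (mulmx (rG g) : 'cV_n -> 'cV_n)))%VS.

Lemma trivial_mx_repr : mx_repr G (fun _ : gT => 1%:M : 'M[F]_1).
Proof. by split=> // g h _ _; rewrite mulmx1. Qed.

Definition trivial_repr : mx_representation F G 1 :=
  MxRepresentation trivial_mx_repr.

Fixpoint tensor_power n (rV : mx_representation F G n) (k : nat) :
    representation F G :=
  if k is k'.+1 then Representation (prod_repr (tensor_power rV k') rV)
  else Representation trivial_repr.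

(* The coefficient of t^k is \dim (V^{(x) k})^G. *)
Definition poincare_series n (rV : mx_representation F G n) : fps F :=
  fun k => (\dim (invariants (tensor_power rV k)))%:R.

End GModules.

Section RepresentationGraph.

Variables (C : closedFieldType) (gT : finGroupType) (G : {group gT}).

(* The index set of the irreducible modules, the module of index l being
   irr_repr l; the index of the trivial module is [1 Lambda]%irr. *)
Definition Lambda : irrType C G := DecSocleType (regular_repr C G).

(* W ranges over the isotypic components of rG; at most one of them is made of
   copies of irr_repr l. *)
Definition irr_multiplicity n (rG : mx_representation C G n) (l : Lambda) :
    nat :=
  (\sum_(W : DecSocleType rG | irr_comp Lambda (socle_repr W) == l)
     socle_mult W)%N.

Variables (n : nat) (rV : mx_representation C G n).

Definition adjacency_mx : 'M[C]_#|Lambda| :=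
  \matrix_(i, j)
    (irr_multiplicity (prod_repr (irr_repr (enum_val i)) rV) (enum_val j))%:R.

Definition affine_node : 'I_#|Lambda| := enum_rank [1 Lambda]%irr.

Definition finite_adjacency_mx : 'M[C]_#|Lambda|.-1 :=
  row' affine_node (col' affine_node adjacency_mx).

End RepresentationGraph.

(* det (I - tA) *)
Definition det_one_sub_tX (R : comNzRingType) m (A : 'M[R]_m) : {poly R} :=
  \det (1%:M - 'X *: map_mx polyC A).

(* Main.v *)
Require Import Defs.
From mathcomp Require Import all_boot all_order all_algebra all_fingroup.
From mathcomp Require Import mxrepresentation character complex reals.
From mathcomp Require Import pgroup.

(** The characters of the irreducible modules satisfy
    [sum_l a_(m, l) chi_l (g) = chi_m (g) * chi_V (g)], so the columns of the
    character table are eigenvectors of [A] with eigenvalues [chi_V (g)].  The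
    table is invertible because irreducible characters are linearly independent
    and as many as the conjugacy classes, hence
    [det (1 - tA) = prod_g (1 - chi_V (g) t)].  Averaging the iterated relation
    over [G] shows that the invariants of the k-th tensor power of [V] have
    dimension [(A ^ k)_(0, 0)]; and the power series of these entries is the
    (0, 0) entry of the inverse of [1 - tA], that is, a cofactor divided by
    [det (1 - tA)]. *)

Import GRing.Theory.
Local Open Scope ring_scope.

(** * Ring laws and division for formal power series *)

Section FormalPowerSeriesTheory.

Variable F : fieldType.
Implicit Types f g h : fps F.

(** Coefficients of a product up to degree [n] depend only on these truncations, so the ring laws of
    polynomials pass to series one coefficient at a time. *)
Definition fps_trunc n f : {poly F} := \poly_(i < n.+1) f i.

Lemma coef_fps_trunc n f i : (i <= n)%N -> (fps_trunc n f)`_i = f i.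
Proof. by move=> le_in; rewrite coef_poly ltnS le_in. Qed.

Lemma coef_fps_mul n f g i :
  (i <= n)%N -> fps_mul f g i = (fps_trunc n f * fps_trunc n g)`_i.
Proof.
move=> le_in; rewrite coefM; apply: eq_bigr => j _.
have le_ji : (j <= i)%N by rewrite -ltnS.
by rewrite !coef_fps_trunc ?(leq_trans le_ji) ?(leq_trans (leq_subr _ _)).
Qed.

Lemma fps_mulA f g h : fps_mul f (fps_mul g h) =1 fps_mul (fps_mul f g) h.
Proof.
move=> n; pose T := fps_trunc n.
transitivity (T f * (T g * T h))`_n.
  rewrite coefM; apply: eq_bigr => i _.
  have le_in : (i <= n)%N by rewrite -ltnS.
  by rewrite coef_fps_trunc // (coef_fps_mul n) // leq_subr.
rewrite mulrA coefM; apply: eq_bigr => i _.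
have le_in : (i <= n)%N by rewrite -ltnS.
by rewrite coef_fps_trunc ?leq_subr // (coef_fps_mul n).
Qed.

Lemma fps_mulC f g : fps_mul f g =1 fps_mul g f.
Proof. by move=> n; rewrite !(coef_fps_mul n) // mulrC. Qed.

Lemma fps_mul1 f : fps_mul f (fps_one F) =1 f.
Proof.
move=> n; rewrite /fps_mul big_ord_recr /= subnn /fps_one mulr1 big1 ?add0r //.
by move=> i _; rewrite subn_eq0 leqNgt ltn_ord mulr0.
Qed.

Lemma eq_fps_mull f1 f2 g : f1 =1 f2 -> fps_mul f1 g =1 fps_mul f2 g.
Proof. by move=> eq_f n; apply: eq_bigr => i _; rewrite eq_f. Qed.

Lemma eq_fps_mulr f g1 g2 : g1 =1 g2 -> fps_mul f g1 =1 fps_mul f g2.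
Proof. by move=> eq_g n; apply: eq_bigr => i _; rewrite eq_g. Qed.

Lemma fps_eq_div f g h : h 0%N != 0 -> fps_mul f h =1 g -> f =1 fps_div g h.
Proof.
move=> h0 fhg n; rewrite /fps_div -(eq_fps_mull _ _ _ fhg) -fps_mulA.
rewrite -[LHS]fps_mul1; apply: eq_fps_mulr => {}n.
by rewrite fps_mulC fps_mulVf.
Qed.

End FormalPowerSeriesTheory.

(** * Diagonal entries of the resolvent of a matrix *)

Section ResolventEntries.

Variable F : fieldType.

(** Evaluation at 0 commutes with the determinant and sends [1 - tA] to the identity. Division by
    this determinant is therefore meaningful. *)
Lemma coef0_det_one_sub_tX m (A : 'M[F]_m) : (det_one_sub_tX A)`_0 = 1.
Proof.
rewrite -horner_coef0 -/(horner_eval 0 _) -det_map_mx -(det1 F m).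
congr (\det _); apply/matrixP => i j.
by rewrite !mxE /= /horner_eval !hornerE -(rmorph_nat polyC) hornerC subr0.
Qed.

Lemma geometric_mx_sum m (B : 'M[{poly F}]_m) n :
  (\sum_(k < n) B ^+ k) *m (1%:M - B) = 1%:M - B ^+ n.
Proof.
elim: n => [|n IHn]; first by rewrite big_ord0 mul0mx expr0 subrr.
rewrite big_ord_recr /= mulmxDl IHn mulmxBr mulmx1 exprSr.
by rewrite addrA subrK.
Qed.

Lemma map_polyC_expr m (A : 'M[F]_m) k :
  map_mx polyC A ^+ k = map_mx polyC (A ^+ k).
Proof.
elim: k => [|k IHk]; first by rewrite !expr0 map_mx1.
by rewrite !exprSr IHk; apply/esym/map_mxM.
Qed.

(** With [B = tA], multiplying the finite geometric sum by the adjugate of [1 - B] gives [(\sum_(k <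
    n.+1) B ^+ k) * det (1 - B) = (1 - B ^+ n.+1) * \adj (1 - B)]. The claim is the coefficient of
    degree [n] in the entry [(i0, i0)]. *)
Lemma fps_diag_powers_mul_det m (A : 'M[F]_m) i0 :
  fps_mul (fun k => (A ^+ k) i0 i0) (fps_of_poly (det_one_sub_tX A))
    =1 fps_of_poly (det_one_sub_tX (row' i0 (col' i0 A))).
Proof.
move=> n; set D := det_one_sub_tX A.
pose B := 'X *: map_mx polyC A.
have BX k : B ^+ k = 'X^k *: map_mx polyC (A ^+ k).
  rewrite -map_polyC_expr; elim: k => [|k IHk]; first by rewrite !expr0 scale1r.
  by rewrite !exprSr IHk -[LHS]scalemxAl -[X in _ *: X]scalemxAr scalerA.
have minor : (\adj (1%:M - B)) i0 i0 = det_one_sub_tX (row' i0 (col' i0 A)).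
  rewrite !mxE /cofactor addnn -signr_odd odd_double mul1r.
  congr (\det _); apply/matrixP => i j; rewrite !mxE.
  by rewrite (inj_eq lift_inj).
have := congr1 (mulmx^~ (\adj (1%:M - B))) (geometric_mx_sum _ B n.+1).
rewrite -mulmxA mul_mx_adj mulmxBl mul1mx BX.
move/(congr1 (fun M : 'M[{poly F}]_m => (M i0 i0)`_n)).
move: (\adj _) minor => adj minor.
rewrite -scalemxAl mul_mx_scalar !mxE minor coefB.
(* The term with [B ^+ n.+1] is a multiple of ['X^n.+1] and vanishes in degree [n]. *)
rewrite ['X^_ * _]mulrC coefMXn ltnSn subr0.
rewrite /fps_of_poly => <-; rewrite -/D summxE mulrC coefM.
apply: eq_bigr => i _; congr (_ * _).
(* The entries of [B ^+ k] are monomials of degree [k], so only [k = i] contributes in degree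
   [i]. *)
under eq_bigr => k _ do rewrite BX !mxE.
rewrite coef_sum (bigD1 i) //= mulrC coefCM coefXn eqxx mulr1 big1 ?addr0 //.
move=> k /negPf ne_ki.
by rewrite mulrC coefCM coefXn eq_sym (inj_eq val_inj) ne_ki mulr0.
Qed.

End ResolventEntries.

(** * Trace and rank of an idempotent matrix *)

Section Idempotents.

Variable F : fieldType.

(** Writing [E = c r] with [c] of full column rank and [r] of full row rank, [E E = E] reads
    [c (r c) r = c r], and both outer factors cancel. *)
Lemma idempotent_mul_base n (E : 'M[F]_n) :
  E *m E = E -> row_base E *m col_base E = 1%:M.
Proof.
move=> EE; apply: (row_full_inj (col_base_full E)).
apply: (row_free_inj (row_base_free E)).
by rewrite mulmx1 mulmxA !mulmx_base -mulmxA mulmx_base.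
Qed.

Lemma mxtrace_idempotent n (E : 'M[F]_n) : E *m E = E -> \tr E = (\rank E)%:R.
Proof.
move=> EE; rewrite -{1}(mulmx_base E) mxtrace_mulC.
by rewrite idempotent_mul_base ?mxtrace1.
Qed.

End Idempotents.

(** * Dimension of the invariants by averaging *)

Section Invariants.

Variables (F : fieldType) (gT : finGroupType) (G : {group gT}).

Lemma invariantsP n (rG : mx_representation F G n) v :
  reflect (forall x, x \in G -> rG x *m v = v) (v \in invariants rG).
Proof.
apply: (iffP subv_bigcapP) => /= inv_v x Gx.
  by have /fixedSpaceP := inv_v x Gx; rewrite lfunE.
by apply/fixedSpaceP; rewrite lfunE /= inv_v.
Qed.

Lemma sum_repr_mull n (rG : mx_representation F G n) x :
  x \in G -> rG x *m (\sum_(y in G) rG y) = \sum_(y in G) rG y.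
Proof.
move=> Gx; rewrite mulmx_sumr [RHS](reindex_inj (mulgI x)) /=.
by apply: eq_big => [y|y Gy]; rewrite ?groupMl // repr_mxM.
Qed.

Lemma sum_repr_mulr n (rG : mx_representation F G n) x :
  x \in G -> (\sum_(y in G) rG y) *m rG x = \sum_(y in G) rG y.
Proof.
move=> Gx; rewrite mulmx_suml [RHS](reindex_inj (mulIg x)) /=.
by apply: eq_big => [y|y Gy]; rewrite ?groupMr // repr_mxM.
Qed.

Lemma mxtrace_repr_conj n (rG : mx_representation F G n) x y :
  x \in G -> y \in G -> \tr (rG (x ^ y)%g) = \tr (rG x).
Proof.
move=> Gx Gy; rewrite conjgE !repr_mxM ?groupM ?groupV // mxtrace_mulC -mulmxA.
by rewrite -repr_mxM ?groupV // mulgV repr_mx1 mulmx1.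
Qed.

(** The average [E] of the group action is a projection onto the invariants, and the trace of an
    idempotent is its rank. *)
Lemma dim_invariants n (rG : mx_representation F G n) :
  #|G|%:R != 0 :> F ->
  (\dim (invariants rG))%:R = #|G|%:R^-1 * \sum_(x in G) \tr (rG x).
Proof.
move=> nzG; pose E := #|G|%:R^-1 *: \sum_(x in G) rG x.
have fixE x : x \in G -> rG x *m E = E.
  by move=> Gx; rewrite -scalemxAr sum_repr_mull.
have avgE v : (forall x, x \in G -> rG x *m v = v) -> E *m v = v.
  move=> inv_v; rewrite -scalemxAl mulmx_suml (eq_bigr _ inv_v) sumr_const.
  by rewrite -scaler_nat scalerA mulVf ?scale1r.
(* [avgE] holds for matrices of any width, in particular for [E], whose columns are invariant. *)
have EE := avgE _ _ fixE.
rewrite -linear_sum -linearZ /= -/E mxtrace_idempotent //.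
(* The column base of [E] parametrizes the invariants injectively by a space of dimension
   [\rank E]. *)
pose f := linfun (mulmx (col_base E) : 'cV_(\rank E) -> 'cV_n).
have rcE := idempotent_mul_base _ _ _ EE.
have Ecb : E *m col_base E = col_base E.
  have /= := congr1 (mulmx^~ (col_base E)) (mulmx_base E).
  by rewrite -mulmxA rcE mulmx1.
have -> : invariants rG = limg f.
  apply/vspaceP => v; apply/invariantsP/memv_imgP => [inv_v | [w _ ->] x Gx].
    exists (row_base E *m v); first exact: memvf.
    by rewrite lfunE /= mulmxA mulmx_base avgE.
  by rewrite lfunE /= -Ecb !mulmxA fixE.
have /eqP ker0 : lker f == 0%VS.
  apply/lker0P/(can_inj (g := mulmx (row_base E))) => w.
  by rewrite lfunE mulmxA rcE mul1mx.
have := limg_ker_dim f fullv; rewrite ker0 capv0 dimv0 add0n => ->.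
by rewrite dimvf /dim /= muln1.
Qed.

End Invariants.

(** * Irreducible characters in characteristic zero *)

Section Irreducibles.

Variables (C : closedFieldType) (gT : finGroupType) (G : {group gT}).
Hypothesis pcharC0 : [pchar C] =i pred0.

Local Notation Lambda := (Lambda C G).

Lemma pchar0_pgroup : ([pchar C]^').-group%g G.
Proof. by apply/pgroupP => p _ _; rewrite inE /= pcharC0. Qed.

Lemma card_Lambda : #|Lambda| = #|classes G|.
Proof.
apply: card_irr_pchar pchar0_pgroup _.
exact: group_closure_closed_field.
Qed.

Lemma gring_op_sum n (rG : mx_representation C G n) M :
  gring_op rG M = \sum_i gring_row M 0 i *: rG (enum_val i).
Proof.
rewrite gring_opE /gring_mx /= mulmx_sum_row linear_sum.
by apply: eq_bigr => i _; rewrite linearZ /= rowK mxvecK.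
Qed.

(** This takes the place of character orthogonality: the central idempotents of the group algebra
    separate the irreducible modules. *)
Lemma gring_op_irr (i j : Lambda) :
  gring_op (irr_repr i) (Wedderburn_id j) = (i == j)%:R%:M.
Proof.
case: eqVneq => [->|ne_ij]; first exact: op_Wedderburn_id_pchar pchar0_pgroup _.
rewrite (irr_repr'_op0_pchar pchar0_pgroup _ (Wedderburn_id_mem j)).
  by rewrite raddf0.
by rewrite eq_sym.
Qed.

(** A relation between the characters on [G] extends linearly to the group algebra. At the central
    idempotent of [j] it leaves [c j] times the degree of [j], which is nonzero in characteristic
    zero. *)
Lemma irr_trace_free (c : Lambda -> C) :
  (forall x, x \in G -> \sum_i c i * \tr (irr_repr i x) = 0) ->
  forall i, c i = 0.
Proof.
move=> c0 j.
have : \sum_i c i * \tr (gring_op (irr_repr i) (Wedderburn_id j)) = 0.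
  under eq_bigr => i _ do rewrite gring_op_sum linear_sum mulr_sumr.
  rewrite exchange_big big1 //= => k _.
  under eq_bigr => i _ do rewrite linearZ /= mulrCA.
  by rewrite -mulr_sumr c0 ?enum_valP ?mulr0.
rewrite (bigD1 j) //= big1 => [|i ne_ij]; last first.
  by rewrite gring_op_irr (negPf ne_ij) raddf0 mxtrace0 mulr0.
rewrite addr0 gring_op_irr eqxx mxtrace1 => /eqP.
rewrite mulf_eq0 => /orP[/eqP // | ].
by rewrite ((pcharf0P _).1 pcharC0) // eqn0Ngt irr_degree_gt0.
Qed.

Lemma sum_irr_repr (i : Lambda) :
  \sum_(x in G) irr_repr i x = (#|G|%:R * (i == [1 Lambda]%irr)%:R)%:M.
Proof.
case: eqVneq => [->|ne_i1].
  rewrite mulr1 (eq_bigr (fun=> 1%:M)) => [|x Gx]; last exact: irr1_repr.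
  by rewrite sumr_const -raddfMn.
set M := \sum_(x in G) _.
(* The sum of the coefficients of an element of the group algebra is the scalar by which it acts on
   the trivial module, and the idempotent of [i] acts there by 0. *)
have sum0 : \sum_k gring_row (Wedderburn_id i) 0 k = 0.
  have := gring_op_irr [1 Lambda]%irr i; rewrite eq_sym (negPf ne_i1) raddf0.
  rewrite gring_op_sum.
  rewrite (eq_bigr (fun k => (gring_row (Wedderburn_id i) 0 k)%:M)).
    rewrite -raddf_sum => /(congr1 mxtrace); rewrite mxtrace0 mxtrace_scalar.
    move/eqP; rewrite -mulr_natr mulf_eq0 => /orP[/eqP // | ].
    by rewrite ((pcharf0P _).1 pcharC0) // eqn0Ngt irr_degree_gt0.
  by move=> k _; rewrite irr1_repr ?enum_valP // scalemx1.
(* The identity of module [i] is the action of its idempotent. Since [M] absorbs group elements on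
   the right, the product is the coefficient sum times [M], that is, 0. *)
rewrite mulr0 raddf0 -[M]mulmx1.
have := gring_op_irr i i; rewrite eqxx => <-.
rewrite gring_op_sum mulmx_sumr.
under eq_bigr => k _ do rewrite -scalemxAr sum_repr_mulr ?enum_valP //.
by rewrite -scaler_suml sum0 scale0r.
Qed.

(** By Maschke's theorem the socle is the whole module, so the trace is a sum over isotypic
    components, which are then grouped by irreducible type. *)
Lemma mxtrace_irr_multiplicity n (rG : mx_representation C G n) x :
  x \in G ->
  \tr (rG x) = \sum_l (irr_multiplicity rG l)%:R * \tr (irr_repr l x).
Proof.
move=> Gx; pose sG := DecSocleType rG.
have soc1 : (Socle sG :=: 1%:M)%MS.
  by rewrite reducible_Socle1 //; apply: mx_Maschke_pchar pchar0_pgroup.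
rewrite -(mxtrace_submod1 (Socle_module sG) soc1) // mxtrace_Socle //.
rewrite (partition_big (fun W : sG => irr_comp Lambda (socle_repr W)) predT) //=.
apply: eq_bigr => l _; rewrite /irr_multiplicity natr_sum mulr_suml.
apply: eq_bigr => W /eqP <-; rewrite mulr_natl; congr (_ *+ _).
apply: mxtrace_rsim Gx; apply: (rsim_irr_comp_pchar _ pchar0_pgroup).
exact: socle_irr.
Qed.

End Irreducibles.

(** * Spectrum and powers of the adjacency matrix *)

Section McKay.

Variables (C : closedFieldType) (gT : finGroupType) (G : {group gT}).
Hypothesis pcharC0 : [pchar C] =i pred0.
Variables (n : nat) (rV : mx_representation C G n).

Local Notation Lambda := (Lambda C G).
Local Notation A := (adjacency_mx rV).

Lemma adjacency_mx_eigen i x :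
  x \in G ->
  \sum_j A i j * \tr (irr_repr (enum_val j) x)
    = \tr (irr_repr (enum_val i) x) * \tr (rV x).
Proof.
move=> Gx; rewrite -mxtrace_prod.
rewrite [RHS](mxtrace_irr_multiplicity _ _ _ pcharC0 _ (prod_repr _ rV) x Gx).
rewrite [RHS](reindex (enum_val : 'I_#|Lambda| -> Lambda)) /=; last first.
  exact/onW_bij/enum_val_bij.
by apply: eq_bigr => j _; rewrite mxE.
Qed.

Lemma adjacency_mx_expr_eigen k i x :
  x \in G ->
  \sum_j (A ^+ k) i j * \tr (irr_repr (enum_val j) x)
    = \tr (irr_repr (enum_val i) x) * \tr (rV x) ^+ k.
Proof.
move=> Gx; elim: k i => [|k IHk] i.
  rewrite !expr0 mulr1 (bigD1 i) //= mxE eqxx mul1r big1 ?addr0 // => j ne_ji.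
  by rewrite mxE eq_sym (negPf ne_ji) mul0r.
rewrite exprS; under eq_bigr => j _ do rewrite mxE mulr_suml.
rewrite exchange_big /=.
under eq_bigr => l _ do under eq_bigr => j _ do rewrite -mulrA.
under eq_bigr => l _ do rewrite -mulr_sumr IHk mulrA.
by rewrite -mulr_suml adjacency_mx_eigen // exprS mulrA.
Qed.

Lemma mxtrace_tensor_power k x :
  \tr (tensor_power rV k x) = \tr (rV x) ^+ k.
Proof.
elim: k => [|k IHk] /=; first by rewrite expr0 mxtrace1.
by rewrite mxtrace_prod IHk exprSr.
Qed.

Lemma poincare_series_adjacency k :
  poincare_series rV k = (A ^+ k) (affine_node C G) (affine_node C G).
Proof.
have nzG : #|G|%:R != 0 :> C.
  by rewrite ((pcharf0P _).1 pcharC0) // -lt0n cardG_gt0.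
rewrite /poincare_series dim_invariants //.
set i0 := affine_node C G.
(* In row [i0] the trivial character is 1, so [adjacency_mx_expr_eigen] expands the character of the
   tensor power into irreducible characters. *)
have -> : \sum_(x in G) \tr (tensor_power rV k x)
    = \sum_(x in G) \sum_j (A ^+ k) i0 j * \tr (irr_repr (enum_val j) x).
  apply: eq_bigr => x Gx.
  rewrite mxtrace_tensor_power adjacency_mx_expr_eigen //.
  by rewrite enum_rankK irr1_repr // mxtrace1 degree_irr1 mul1r.
rewrite exchange_big /=.
under eq_bigr => j _ do rewrite -mulr_sumr -linear_sum sum_irr_repr //.
rewrite (bigD1 i0) //= big1 => [|j ne_j0]; last first.
  rewrite -(inj_eq enum_val_inj) enum_rankK in ne_j0.
  by rewrite (negPf ne_j0) mulr0 raddf0 mxtrace0 mulr0.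
rewrite enum_rankK eqxx mulr1 mxtrace_scalar degree_irr1 addr0.
by rewrite mulrCA mulVf ?mulr1.
Qed.

Lemma det_adjacency_mx (Gamma : {set gT}) :
  is_transversal Gamma (classes G) G ->
  det_one_sub_tX A = \prod_(x in Gamma) (1 - (\tr (rV x))%:P * 'X).
Proof.
move=> trGamma.
have eqc : #|Lambda| = #|Gamma|.
  by rewrite card_Lambda // (card_transversal trGamma).
(* Numbering the classes by the indices of the irreducible modules makes the character table [X] a
   square matrix. *)
pose gam j := enum_val (cast_ord eqc j).
have Ggam j : gam j \in G.
  by apply: (subsetP (transversal_sub trGamma)); apply: enum_valP.
pose X : 'M[C]_#|Lambda| := \matrix_(i, j) \tr (irr_repr (enum_val i) (gam j)).
pose d : 'rV[{poly C}]_#|Lambda| := \row_j (1 - (\tr (rV (gam j)))%:P * 'X).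
(* A vector [u] with [u *m X = 0] is a relation between irreducible characters on [Gamma]. As
   characters are class functions it holds on all of [G], so [u] is zero. *)
have unitX : X \in unitmx.
  rewrite -row_free_unit -kermx_eq0; apply/rowV0P => u /sub_kermxP uX0.
  apply/rowP => i; rewrite mxE -(enum_valK i).
  apply: (irr_trace_free _ _ _ pcharC0 (fun l => u 0 (enum_rank l))) => x Gx.
  have clx := mem_classes Gx; pose y := transversal_repr x Gamma (x ^: G)%g.
  have Gamma_y : y \in Gamma by apply: repr_mem_transversal trGamma _ _ clx.
  have /imsetP[z Gz def_y] : y \in (x ^: G)%g
    by apply: repr_mem_pblock trGamma _ _ clx.
  pose j := cast_ord (esym eqc) (enum_rank_in Gamma_y y).
  have gam_j : gam j = (x ^ z)%g by rewrite /gam cast_ordKV enum_rankK_in.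
  transitivity ((u *m X) 0 j); last by rewrite uX0 mxE.
  rewrite mxE [LHS](reindex (enum_val : 'I_#|Lambda| -> Lambda)) /=; last first.
    exact/onW_bij/enum_val_bij.
  apply: eq_bigr => l _; rewrite enum_valK mxE gam_j.
  by rewrite mxtrace_repr_conj.
have eigX : (1%:M - 'X *: map_mx polyC A) *m map_mx polyC X
    = map_mx polyC X *m diag_mx d.
  apply/matrixP => i j; rewrite mulmxBl mul1mx -scalemxAl -map_mxM.
  rewrite mul_mx_diag !mxE.
  rewrite mulrBr mulr1 mulrA -polyCM mulrC; congr (_ - _%:P * _).
  rewrite -adjacency_mx_eigen //; apply: eq_bigr => l _; congr (_ * _).
  by rewrite mxE.
have detX : \det (map_mx polyC X) != 0.
  by rewrite det_map_mx polyC_eq0 -unitfE -unitmxE.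
(* Taking determinants in [eigX] puts the factor [\det X] on both sides, where it cancels. *)
apply: (mulIf detX).
rewrite /det_one_sub_tX -det_mulmx eigX det_mulmx det_diag mulrC; congr (_ * _).
rewrite [RHS]big_enum_val /= [RHS](reindex (cast_ord eqc)) /=; last first.
  exact: onW_bij (Bijective (cast_ordK eqc) (cast_ordKV eqc)).
by apply: eq_bigr => j _; rewrite mxE.
Qed.

End McKay.

(** * The Poincaré series as a quotient of determinants *)

Theorem theorem3p1 (R : realType) (gT : finGroupType) (G : {group gT})
    (rV : mx_representation R[i] G 2)
    (rV_faithful : mx_faithful rV)
    (rV_SU2 : forall g, g \in G -> special_unitary (rV g))
    (Gamma : {set gT}) (Gamma_repr : is_transversal Gamma (classes G) G) :
  let A := adjacency_mx rV in
  let A0 := finite_adjacency_mx rV in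
  let N := fps_of_poly (det_one_sub_tX A0) in
  let D := fps_of_poly (det_one_sub_tX A) in
  let P := fps_of_poly (\prod_(g in Gamma) (1 - (\tr (rV g))%:P * 'X)) in
  poincare_series rV =1 fps_div N D /\ fps_div N D =1 fps_div N P.
Proof.
move=> A A0 N D P.
have pcharC0 : [pchar R[i]] =i pred0 := @Num.Theory.pchar_num _.
(* The second equality holds because the two denominators are the same polynomial. *)
split; last by rewrite /D /P (det_adjacency_mx _ _ _ pcharC0 _ _ _ Gamma_repr).
apply: fps_eq_div.
  by rewrite /D /fps_of_poly coef0_det_one_sub_tX oner_eq0.
move=> k; apply: etrans (fps_diag_powers_mul_det _ _ A (affine_node _ G) k).
apply: eq_fps_mull => {}k.
exact: poincare_series_adjacency.
Qed.
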